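(* Let $n,r\geq 1$. In the prisoners-and-rooms game with $n$ prisoners and $r$ rooms, all rooms initially in state $0$, the prisoners have a symmetric winning strategy for some number of states $q$ if and only if $\gcd(n,r)=1$. Furthermore, there is a function $f:\mathbb{Z}^+\to\mathbb{Z}^+$ such that for every pair $n,r$ with $\gcd(n,r)=1$ and every $q\geq f(\min(n,r))$, the prisoners have a symmetric winning strategy with $q$ states, starting from all rooms in state $0$.
   Context: The game: there are $n$ prisoners and $r$ rooms; each room contains a switch that is in one of $q$ states $\{0,1,\ldots,q-1\}$. The initial state of every room is known to the prisoners. A warden leads prisoners into rooms one at a time according to a schedule, i.e. an infinite sequence of (prisoner, room) pairs; a schedule is valid if every prisoner visits every room infinitely often. The rooms are indistinguishable to the prisoners, and prisoners have no information about time or other visits: on each visit a prisoner observes only the current state of the room, may change it to any state, and may declare that all prisoners have visited all rooms. A (deterministic) strategy assigns to each prisoner a rule determining, from the sequence of states that prisoner has observed so far (and their own previous actions), what new state to set and whether to declare. A strategy is winning if for every valid schedule some prisoner eventually declares, and every declaration is made only at a time when every prisoner has already visited every room. A strategy is symmetric if all prisoners follow the same rule (the same function of their own observation history). *)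

(* Defs.v *)
From mathcomp Require Import all_boot.
Set Implicit Arguments. Unset Strict Implicit. Unset Printing Implicit Defensive.

(* A schedule: at time t, prisoner (sched t).1 is led into room (sched t).2. *)
Definition schedule (n r : nat) := nat -> 'I_n * 'I_r.

Definition valid_schedule n r (sched : schedule n r) : Prop :=
  forall (p : 'I_n) (k : 'I_r) (t : nat), exists t', t <= t' /\ sched t' = (p, k).

(* A symmetric (deterministic) strategy: a single rule used by every prisoner.
   Input: the sequence of states the prisoner has observed so far (oldest first,
   the last element being the state observed on the current visit).  Since the
   rule is deterministic, the prisoner's own previous actions are functions of
   this sequence.  Output: new state of the room, and whether to declare. *)
Definition sym_strategy (q : nat) := seq 'I_q -> 'I_q * bool.

Fixpoint config n r q (S : sym_strategy q) (init : 'I_r -> 'I_q)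
    (sched : schedule n r) (t : nat) : ('I_r -> 'I_q) * ('I_n -> seq 'I_q) :=
  match t with
  | 0 => (init, fun _ => [::])
  | t'.+1 =>
      let: (rooms, hist) := config S init sched t' in
      let: (p, k) := sched t' in
      let h := rcons (hist p) (rooms k) in
      ((fun j => if j == k then (S h).1 else rooms j),
       (fun p' => if p' == p then h else hist p'))
  end.

Definition declares n r q (S : sym_strategy q) init (sched : schedule n r) t : bool :=
  let: (rooms, hist) := config S init sched t in
  let: (p, k) := sched t in
  (S (rcons (hist p) (rooms k))).2.

Definition all_visited n r (sched : schedule n r) (t : nat) : Prop :=
  forall (p : 'I_n) (k : 'I_r), exists t', t' <= t /\ sched t' = (p, k).

Definition winning (n r : nat) q (S : sym_strategy q) (init : 'I_r -> 'I_q) : Prop :=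
  forall sched : schedule n r, valid_schedule sched ->
    (exists t, declares S init sched t) /\
    (forall t, declares S init sched t -> all_visited sched t).
Arguments winning n r {q} S init.

Definition sym_winnable (n r q : nat) : Prop :=
  exists (Hq : 0 < q), exists S : sym_strategy q,
    winning n r S (fun _ => Ordinal Hq).

(* Main.v *)
Require Import Defs.
From mathcomp Require Import all_boot all_order all_algebra zify.

Set Implicit Arguments. Unset Strict Implicit. Unset Printing Implicit Defensive.
Import Order.TTheory Num.Theory.

(* If n and r are coprime, write a n = b r + 1.  Every prisoner starts with
   charge a and one token, and pays b when opening a fresh room, so that the
   total charge is 1 once all rooms are open.  Prisoners in debt leave unit
   debts in rooms, to be absorbed by prisoners of positive charge; prisoners of
   charge 0 leave their tokens in rooms, to be collected by those of positive
   charge.  In the end a single prisoner has positive charge and holds all n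
   tokens; since tokens are conserved, holding n of them certifies a unique
   leader.  The leader then calls one room at a time, the colour of the call
   alternating so that everybody answers exactly once per round; after n marks
   (its own included) everybody has visited that room.  Eight states suffice,
   whatever n and r are.

   If d = gcd(n, r) > 1, blocks of d prisoners can be led in lockstep through
   blocks of d rooms.  The members of a block stay in identical situations
   whatever cyclic shift matches prisoners with rooms, so the warden may use
   shift 0 until the first declaration, when prisoner 0 has not seen room 1. *)

(** * Sums under one-point updates, and a liveness principle *)

Definition upd (T : eqType) (U : Type) (f : T -> U) (i : T) (v : U) : T -> U :=
  fun j => if j == i then v else f j.

Lemma big_upd (U : Type) (idx : U) (op : Monoid.com_law idx) (I : finType)
    (T : Type) (F : T -> U) (f : I -> T) (i : I) (v : T) :
  op (\big[op/idx]_j F (upd f i v j)) (F (f i)) =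
  op (\big[op/idx]_j F (f j)) (F v).
Proof.
rewrite (bigD1 i) //= [in RHS](bigD1 i) //= {1}/upd eqxx.
rewrite (eq_bigr (fun j => F (f j))) => [|j /negbTE ne]; last by rewrite /upd ne.
by rewrite -Monoid.mulmA [RHS]Monoid.mulmC; congr (op _ _); rewrite Monoid.mulmC.
Qed.

Lemma sum_upd (I : finType) (T : Type) (F : T -> nat) (f : I -> T) i v :
  \sum_j F (upd f i v j) + F (f i) = \sum_j F (f j) + F v.
Proof. exact: big_upd. Qed.

Lemma sumz_upd (I : finType) (T : Type) (F : T -> int) (f : I -> T) i v :
  (\sum_j F (upd f i v j) + F (f i) = \sum_j F (f j) + F v)%R.
Proof. exact: big_upd. Qed.

(** Weak fairness: a useful pair stays useful, without raising [mu], until [mu] drops, and [mu] must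
    drop at the latest when that pair is scheduled. Since every pair recurs, [mu] would decrease
    forever if [goal] were never reached. *)
Lemma eventually (P : Type) (sched : nat -> P) (mu : nat -> nat)
    (goal : nat -> Prop) (en : nat -> P -> Prop) (t0 : nat) :
  (forall x t, exists t', t <= t' /\ sched t' = x) ->
  (forall t, t0 <= t -> goal t \/ exists x, en t x) ->
  (forall t x, t0 <= t -> en t x -> mu t.+1 < mu t \/
     [/\ sched t <> x, mu t.+1 <= mu t & en t.+1 x]) ->
  exists2 t, t0 <= t & goal t.
Proof.
move=> fair live step.
(* The induction is on the waiting time [k] until [x] is scheduled. *)
have drop k t x : t0 <= t -> en t x -> sched (t + k) = x ->
    exists2 t', t0 <= t' & mu t' < mu t.
  elim: k t => [|k IHk] t le_t en_x; rewrite ?addn0.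
    by move=> sx; case: (step _ _ le_t en_x) => [lt|[]//]; exists t.+1 => //; lia.
  rewrite addnS -addSn => sx.
  case: (step _ _ le_t en_x) => [lt|[_ le en']]; first by exists t.+1 => //; lia.
  have [|t' ? ?] := IHk t.+1 _ en' sx; first by lia.
  by exists t' => //; lia.
suff H N t : mu t < N -> t0 <= t -> exists2 t, t0 <= t & goal t.
  exact: (H (mu t0).+1 t0).
elim: N t => [|N IHN] t // lt_N le_t.
case: (live t le_t) => [gt|[x en_x]]; first by exists t.
have [t' [le_tt' sx]] := fair x t.
have [|t'' le'' lt''] := @drop (t' - t) t x le_t en_x; first by rewrite subnKC.
by apply: (IHN t'') => //; lia.
Qed.

(** * The eight-state protocol *)

(* A room is in one of the first four states until the leader calls it, possibly
   long after the election; [Token] does not occur once there is a leader. *)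
Inductive room := Fresh | Empty | Debt | Token | Call of bool | Ack | Done.

(* [mark] is the colour of the last call answered and [acks] the number of marks
   made in the current round (0 between rounds); round [finished] uses the colour
   [odd finished], and the initial mark is [true], so round 0 is unanswered. *)
Record memory := Memory {
  charge : int; tokens : nat; mark : bool; acks : nat; finished : nat }.

(** The test [w == n] is how a prisoner recognises itself as leader. Calling a room counts as the
    leader's own mark, so [a] restarts at 1. A room is closed only from [Call], when no answer is
    pending in it. *)
Definition trans (b n : nat) (m : memory) (s : room) : memory * room :=
  let: Memory c w e a d := m in
  if w == n then
    match s with
    | Call _ => if a == n then (Memory c w e 0 d.+1, Done) else (m, s)
    | Ack => (Memory c w e a.+1 d, Call (odd d))
    | Done => (m, s)
    | _ => if a == 0 then (Memory c w (odd d) 1 d, Call (odd d)) else (m, s)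
    end
  else
    match s with
    | Fresh => (Memory (c - Posz b)%R w e a d, Empty)
    | Empty => if (c < 0)%R then (Memory (c + 1)%R w e a d, Debt)
               else if (c == 0%R) && (0 < w) then (Memory c w.-1 e a d, Token)
               else (m, s)
    | Debt => if (0 < c)%R then (Memory (c - 1)%R w e a d, Empty) else (m, s)
    | Token => if (0 < c)%R then (Memory c w.+1 e a d, Empty) else (m, s)
    | Call e' => if e == e' then (m, s) else (Memory c w e' a d, Ack)
    | _ => (m, s)
    end.

Definition state n r := (('I_n -> memory) * ('I_r -> room))%type.

Definition step b n r (x : state n r) (pk : 'I_n * 'I_r) : state n r :=
  let y := trans b n (x.1 pk.1) (x.2 pk.2) in
  (upd x.1 pk.1 y.1, upd x.2 pk.2 y.2).

Definition initial a n r : state n r :=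
  (fun _ => Memory (Posz a) 1 true 0 0, fun _ => Fresh).

Definition run a b n r (sched : schedule n r) (t : nat) : state n r :=
  iteri t (fun t' x => step b x (sched t')) (initial a n r).

(** * The gathering phase: conserved quantities and progress *)

Definition gathering (s : room) : bool :=
  match s with Fresh | Empty | Debt | Token => true | _ => false end.
Definition room_charge (b : nat) (s : room) : int :=
  match s with Fresh => (- Posz b)%R | Debt => (-1)%R | _ => 0%R end.
Definition room_tokens (s : room) : nat := if s is Token then 1 else 0.
Definition is_ack (s : room) : bool := if s is Ack then true else false.
Definition is_done (s : room) : bool := if s is Done then true else false.
Definition is_active (s : room) : bool :=
  match s with Call _ | Ack => true | _ => false end.

(* Any exchange of charge outweighs the at most 2n units that the tokens of a
   prisoner contribute when its charge stops being positive. *)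
Definition pot_mem (n : nat) (m : memory) : nat :=
  n.*2.+1 * absz (charge m) + (if (charge m <= 0)%R then (tokens m).*2 else 0).
Definition pot_room (b n : nat) (s : room) : nat :=
  match s with Fresh => n.*2.+1 * b.+1 | Token => 1 | _ => 0 end.
Definition pot b n r (x : state n r) : nat :=
  \sum_p pot_mem n (x.1 p) + \sum_k pot_room b n (x.2 k).

(** Opening a room adds at most [b] to the absolute charge, and the extra unit in [b.+1] pays for
    tokens that start to count. Moving a debt brings a charge one unit closer to 0. A dropped token
    goes from weight 2 to 1, a collected one from 1 to 0. *)
Lemma trans_pot b n m s : tokens m < n -> gathering s ->
  let y := trans b n m s in
  y = (m, s) \/
  pot_mem n y.1 + pot_room b n y.2 < pot_mem n m + pot_room b n s.
Proof.
case: m => c w e a d /= ltw; rewrite ltn_eqF // /pot_mem.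
case: s => //= _.
- right; set N := n.*2.+1; rewrite addn0 mulnSr.
  suff : N * absz (c - Posz b)%R <= N * absz c + N * b by do 2 case: ifP; lia.
  by rewrite -mulnDr leq_mul2l; lia.
- case: ifP => c0; last first.
    by case: ifP => [/andP[/eqP -> w0]|]; [right => /=; lia | left].
  right => /=; have -> : absz c = (absz (c + 1)%R).+1 by lia.
  by rewrite mulnSr !ifT; lia.
- case: ifP => c0; [right => /=|by left].
  have -> : absz c = (absz (c - 1)%R).+1 by lia.
  by rewrite mulnSr; do 2 case: ifP; lia.
- by case: ifP => c0; [right => /=; rewrite !ifF; lia|left].
Qed.

Lemma trans_gathering b n m s : tokens m < n -> gathering s ->
  let y := trans b n m s in
  [/\ gathering y.2, mark y.1 = mark m, acks y.1 = acks m &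
      finished y.1 = finished m].
Proof.
case: m => c w e a d /= ltw; rewrite ltn_eqF //.
by case: s => //= _; do ?case: ifP.
Qed.

Lemma trans_tokens b n m s : tokens m < n -> gathering s ->
  let y := trans b n m s in
  tokens y.1 + room_tokens y.2 = tokens m + room_tokens s.
Proof.
case: m => c w e a d /= ltw; rewrite ltn_eqF //.
by case: s => //= _; do ?case: ifP => //=; lia.
Qed.

Lemma trans_charge b n m s : tokens m < n -> gathering s ->
  let y := trans b n m s in
  (charge y.1 + room_charge b y.2 = charge m + room_charge b s)%R.
Proof.
case: m => c w e a d /= ltw; rewrite ltn_eqF //.
by case: s => //= _; do ?case: ifP => //=; lia.
Qed.

(** The old local terms are added on the left instead of subtracted on the right, since subtraction
    on [nat] truncates. Local conservation laws then become global ones by cancellation. *)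
Lemma step_sum b n r (x : state n r) p k (F : memory -> nat) (G : room -> nat) :
  let y := trans b n (x.1 p) (x.2 k) in
  \sum_i F ((step b x (p, k)).1 i) + \sum_j G ((step b x (p, k)).2 j) +
    (F (x.1 p) + G (x.2 k)) =
  \sum_i F (x.1 i) + \sum_j G (x.2 j) + (F y.1 + G y.2).
Proof.
move=> y; rewrite addnACA [RHS]addnACA.
by congr addn; apply: sum_upd.
Qed.

Lemma step_sumz b n r (x : state n r) p k (F : memory -> int) (G : room -> int) :
  let y := trans b n (x.1 p) (x.2 k) in
  (\sum_i F ((step b x (p, k)).1 i) + \sum_j G ((step b x (p, k)).2 j) +
    (F (x.1 p) + G (x.2 k)) =
  \sum_i F (x.1 i) + \sum_j G (x.2 j) + (F y.1 + G y.2))%R.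
Proof.
move=> y; rewrite GRing.addrACA [RHS]GRing.addrACA.
by congr (_ + _)%R; apply: sumz_upd.
Qed.

(** A fresh room counts as [- b], so the total charge equals [a * n - b * r = 1] from the start, not
    only once all rooms are open. *)
Record gather_inv (b n r : nat) (x : state n r) : Prop := GatherInv {
  gather_rooms : forall k, gathering (x.2 k);
  gather_mems : forall p,
    [/\ mark (x.1 p), acks (x.1 p) = 0 & finished (x.1 p) = 0];
  gather_tokens : \sum_p tokens (x.1 p) + \sum_k room_tokens (x.2 k) = n;
  gather_charge :
    (\sum_p charge (x.1 p) + \sum_k room_charge b (x.2 k) = 1)%R }.

Definition leaderless n r (x : state n r) : Prop := forall p, tokens (x.1 p) < n.

Lemma gather_initial a b n r :
  a * n = b * r + 1 -> gather_inv b (initial a n r).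
Proof.
move=> bezout; split => //=.
- by rewrite !sum_nat_const !card_ord muln0 addn0 muln1.
- have mulE (c : int) k : (c *+ k = c * Posz k)%R.
    by rewrite -GRing.mulr_natr natz.
  rewrite !GRing.sumr_const !card_ord /= !mulE GRing.mulNr -!PoszM bezout; lia.
Qed.

Lemma gather_step b n r (x : state n r) pk :
  gather_inv b x -> leaderless x -> gather_inv b (step b x pk).
Proof.
case: pk => p k [Rx Mx Tx Cx] noL.
have [Ry Ky Ay Fy] := trans_gathering b (noL p) (Rx k).
split.
- by move=> j; rewrite /= /upd; case: ifP.
- by move=> i; rewrite /= /upd; case: ifP; rewrite ?Ky ?Ay ?Fy.
- have := step_sum b x p k tokens room_tokens.
  by rewrite /= (trans_tokens b (noL p) (Rx k)) Tx => /addIn.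
- have := step_sumz b x p k charge (room_charge b).
  by rewrite /= (trans_charge b (noL p) (Rx k)) Cx => /GRing.addIr.
Qed.

Lemma sum_ge1 (I : finType) (F : I -> nat) i : F i <= \sum_j F j.
Proof. by rewrite (bigD1 i) //= leq_addr. Qed.

(** Rooms never carry positive charge and the total is 1, so some prisoner [p] has positive charge
    and can act on any nonempty room. If all rooms are empty and nobody in debt or at charge 0 can
    act, then [p] alone has nonzero charge and holds all [n] tokens, so it is a leader. *)
Lemma gather_progress b n r (x : state n r) : 0 < r ->
  gather_inv b x -> leaderless x ->
  exists p k, let y := trans b n (x.1 p) (x.2 k) in
    pot_mem n y.1 + pot_room b n y.2 <
    pot_mem n (x.1 p) + pot_room b n (x.2 k).
Proof.
move=> r_gt0 [Rx Mx Tx Cx] noL.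
(* By [trans_pot] a move that changes the room must lower the potential. *)
suff [p [k ne]] : exists p k,
    (trans b n (x.1 p) (x.2 k)).2 <> x.2 k.
  exists p, k => y.
  by case: (trans_pot b (noL p) (Rx k)) => // E; rewrite E in ne.
have [/existsP[p c_gt0]|c_le0] := boolP [exists p, (0 < charge (x.1 p))%R];
  last first.
  suff : (\sum_p charge (x.1 p) + \sum_k room_charge b (x.2 k) <= 0)%R by lia.
  rewrite -[0%R]GRing.addr0 lerD // sumr_le0 // => i _.
    by move/existsPn: c_le0 => /(_ i); rewrite -leNgt.
  by case: (x.2 i) => //=; lia.
have [/existsP[k nE]|allE] :=
    boolP [exists k, if x.2 k is Empty then false else true].
  exists p, k; have := noL p; have := Rx k; move: nE c_gt0.
  case: (x.1 p) => c w e u d /=; case: (x.2 k) => //= _ c_gt0 _ ltw;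
  by rewrite ltn_eqF // ?c_gt0.
have {}allE k : x.2 k = Empty.
  by move/existsPn: allE => /(_ k); case: (x.2 k).
have [/existsP[q act]|idle] := boolP [exists q,
    (charge (x.1 q) < 0)%R || (charge (x.1 q) == 0%R) && (0 < tokens (x.1 q))].
  exists q, (Ordinal r_gt0); rewrite allE; have := noL q; move: act.
  case: (x.1 q) => c w e u d /= act ltw; rewrite ltn_eqF //.
  by case: ifP act => //= _ ->.
have {}idle q : (0 <= charge (x.1 q))%R /\
    (charge (x.1 q) = 0%R -> tokens (x.1 q) = 0).
  by move/existsPn: idle => /(_ q); lia.
have room0 (F : room -> nat) : F Empty = 0 -> \sum_k F (x.2 k) = 0.
  by move=> F0; rewrite big1 // => k _; rewrite allE.
(* Nonnegative integers with sum 1, one of which, that of [p], is already positive. *)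
have others q : q != p -> charge (x.1 q) = 0%R.
  move=> ne; move: Cx; rewrite (bigD1 p) //= (bigD1 q) //=.
  rewrite [X in (_ + X)%R]big1; last by move=> k _; rewrite allE.
  set S := (\sum_(i | _) _)%R; suff : (0 <= S)%R.
    by have [] := idle q; lia.
  by apply: sumr_ge0 => i _; case: (idle i).
move: (noL p) Tx; rewrite room0 // addn0 (bigD1 p) //= big1 ?addn0; first by lia.
by move=> q /others /(idle q).2.
Qed.

(** * The service phase: invariant and its preservation *)

Definition idle (s : room) : bool :=
  match s with Fresh | Empty | Debt => true | _ => false end.

Definition served (e : bool) (s : room) : bool :=
  match s with Token => false | Call e' => e' == e | _ => true end.

(** [V] abstracts the visits made so far. A room in state [Ack] holds a mark not yet counted by the
    leader, whence the sum in [serve_marks]; [serve_active] also says that at most one room is being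
    served. The last field carries the certificate: carrying the current colour proves a visit to
    the active room. *)
Record serve_inv n r (x : state n r) (V : 'I_n -> 'I_r -> Prop) (L : 'I_n) : Prop :=
  ServeInv {
  serve_leader : tokens (x.1 L) = n;
  serve_follower : forall p, p != L -> tokens (x.1 p) = 0 /\ finished (x.1 p) = 0;
  serve_rooms : forall k, served (odd (finished (x.1 L))) (x.2 k);
  serve_active : \sum_k is_active (x.2 k) = (0 < acks (x.1 L));
  serve_marks : \sum_p (mark (x.1 p) == odd (finished (x.1 L))) =
                acks (x.1 L) + \sum_k is_ack (x.2 k);
  serve_leader_mark :
    0 < acks (x.1 L) -> mark (x.1 L) = odd (finished (x.1 L));
  serve_done : \sum_k is_done (x.2 k) = finished (x.1 L);
  serve_visited : forall p k,
    is_done (x.2 k) || is_active (x.2 k) &&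
      (mark (x.1 p) == odd (finished (x.1 L))) -> V p k }.

Lemma sum_ge2 (I : finType) (F : I -> nat) i j : i != j ->
  F i + F j <= \sum_l F l.
Proof.
by move=> ne; rewrite (bigD1 i) //= (bigD1 j) 1?eq_sym //= addnA leq_addr.
Qed.

(** Covers every move that does not close a round. The last two premises protect [serve_visited]: a
    room becomes active only while nobody carries the current colour, and the colour is acquired
    only when no room other than [k] is active. *)
Lemma serve_upd n r (x : state n r) (V V' : 'I_n -> 'I_r -> Prop) L p k m s :
  let d := odd (finished (x.1 L)) in
  let mL := upd x.1 p m L in
  serve_inv x V L -> (forall i j, V i j -> V' i j) -> V' p k ->
  finished m = finished (x.1 p) -> tokens m = tokens (x.1 p) ->
  served d s -> is_done s = is_done (x.2 k) ->
  is_active (x.2 k) + (0 < acks mL) = is_active s + (0 < acks (x.1 L)) ->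
  (mark m == d) + (acks (x.1 L) + is_ack (x.2 k)) =
    (mark (x.1 p) == d) + (acks mL + is_ack s) ->
  (0 < acks mL -> mark mL = d) ->
  (is_active s -> is_active (x.2 k) \/ forall i, mark (x.1 i) != d) ->
  (mark m == d -> mark (x.1 p) == d \/ forall j, j != k -> ~~ is_active (x.2 j)) ->
  serve_inv (upd x.1 p m, upd x.2 k s) V' L.
Proof.
move=> d mL [wL wF RL act mk mkL dn vis] sub Vpk fm tm sv dns acts mks mkL' newA newM.
have dE : finished mL = finished (x.1 L).
  by rewrite /mL /upd; case: eqP => // ->.
split=> //=; rewrite -/mL ?dE -/d.
- by rewrite /mL /upd; case: eqP wL => // -> ; rewrite tm.
- by move=> i ne; rewrite /upd; case: eqP => [E|_]; rewrite ?fm ?tm -?E; apply: wF.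
- by move=> j; rewrite /upd; case: eqP.
- apply: (@addIn (is_active (x.2 k))).
  rewrite (sum_upd (fun s => is_active s : nat)) act.
  by rewrite addnC -acts addnC.
- have := sum_upd (fun s => is_ack s : nat) x.2 k s.
  have := sum_upd (fun m => (mark m == d) : nat) x.1 p m.
  rewrite mk; move: mks; clear; do !move: (nat_of_bool _) => ?.
  do !move: (\sum_(i < _) _) => ?; lia.
- exact: mkL'.
- have := sum_upd (fun s => is_done s : nat) x.2 k s.
  by rewrite /= dns dn => /addIn.
- move=> i j; move: (vis i j); rewrite /upd.
  case: (eqVneq j k) => [->|nj]; case: (eqVneq i p) => [->|ni] //.
  + move=> visij; rewrite dns => /orP[dj|/andP[aj mi]].
      by apply/sub/visij; rewrite dj.
    have [ak|no] := newA aj; last by rewrite (negbTE (no i)) in mi.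
    by apply/sub/visij; rewrite ak mi orbT.
  + move=> visij /orP[dj|/andP[aj mi]]; first by apply/sub/visij; rewrite dj.
    have [mi'|no] := newM mi; last by rewrite (negbTE (no _ nj)) in aj.
    by apply/sub/visij; rewrite aj mi' orbT.
  + by move=> visij /visij /sub.
Qed.

(** For the service phase, late gathering moves only exchange idle room states; answering a call is
    the one move that matters. *)
Lemma trans_follower b n m s : 0 < n -> tokens m = 0 -> s <> Token ->
  let y := trans b n m s in
  [/\ tokens y.1 = 0, finished y.1 = finished m &
    (mark y.1 = mark m /\ (y.2 = s \/ idle s /\ idle y.2)) \/
    (exists2 e, s = Call e & [/\ mark m != e, mark y.1 = e & y.2 = Ack])].
Proof.
case: m => c w e a d n_gt0 /= ->; rewrite ltn_eqF // andbF.
case: s => [||||e'||] //= _.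
- by split=> //; left; split=> //; right.
- by case: ifP; split=> //; left; split=> //; right.
- by case: ifP; split=> //; left; split=> //; right.
- case: ifP => ne; split=> //; [by left; split=> //; left | right].
  by eexists; first reflexivity; rewrite ne.
- by split=> //; left; split=> //; left.
- by split=> //; left; split=> //; left.
Qed.

Lemma trans_leader b n m s : tokens m = n ->
  trans b n m s =
  match s with
  | Call _ =>
      if acks m == n
      then (Memory (charge m) n (mark m) 0 (finished m).+1, Done) else (m, s)
  | Ack => (Memory (charge m) n (mark m) (acks m).+1 (finished m),
            Call (odd (finished m)))
  | Done => (m, s)
  | _ => if acks m == 0
         then (Memory (charge m) n (odd (finished m)) 1 (finished m),
               Call (odd (finished m)))
         else (m, s)
  end.
Proof. by case: m => c w e a d /= ->; rewrite eqxx. Qed.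

(** All moves go through [serve_upd] except the closing of a round, where the current colour flips
    and the whole invariant is rebuilt. *)
Lemma serve_step b n r (x : state n r) (V V' : 'I_n -> 'I_r -> Prop) L p k :
  serve_inv x V L -> (forall i j, V i j -> V' i j) -> V' p k ->
  serve_inv (step b x (p, k)) V' L.
Proof.
move=> inv sub Vpk; have n_gt0 : 0 < n by apply: leq_ltn_trans (ltn_ord L).
have [wL wF RL act mk mkL dn vis] := inv.
have uniq j : is_active (x.2 k) -> j != k -> ~~ is_active (x.2 j).
  move=> ak ne; have := @sum_ge2 _ (fun j => is_active (x.2 j) : nat) _ _ ne.
  by rewrite act ak; case: is_active => //; case: (0 < _).
have marked_le i : (mark (x.1 i) == odd (finished (x.1 L))) <=
    acks (x.1 L) + \sum_k is_ack (x.2 k).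
  by rewrite -mk (@sum_ge1 _ (fun i => (mark (x.1 i) == _) : nat)).
have ack_le : \sum_j is_ack (x.2 j) <= \sum_j is_active (x.2 j).
  by apply: leq_sum => j _; case: (x.2 j).
rewrite /step /=; case: (eqVneq p L) => [pL|ne]; last first.
  have [w0 f0] := wF p ne.
  have nT : x.2 k <> Token by move=> E; have := RL k; rewrite E.
  have := trans_follower b n_gt0 w0 nT.
  case: trans => m s /= [w0' f' H].
  have updL : upd x.1 p m L = x.1 L by rewrite /upd eq_sym (negbTE ne).
  apply: (serve_upd inv sub Vpk); rewrite ?updL ?w0 //.
  - case: H => [[_ [->|[_]]]|[e _ [_ _ ->]]] //; by [apply: RL | case: s].
  - by case: H => [[_ [->|[]]]|[e -> [_ _ ->]]] //; case: s; case: (x.2 k).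
  - by case: H => [[_ [->|[]]]|[e -> [_ _ ->]]] //; case: s; case: (x.2 k).
  - case: H => [[-> [->|[]]]|[e kE [me me' ->]]] //.
      by case: s; case: (x.2 k).
    have := RL k; rewrite kE me' => /eqP eE; move: me; rewrite -eE eqxx => /negbTE -> /=.
    lia.
  - by case: H => [[_ [->|[]]]|[e -> [_ _ ->]]] //; [left| case: s; case: (x.2 k)|left].
  - case: H => [[-> _]|[e kE _]] => [|_]; first by left.
    by right=> j; apply: uniq; rewrite kE.
move: Vpk; rewrite pL => VLk.
rewrite (trans_leader b (x.2 k) wL).
set m := x.1 L; set d := odd (finished m).
have updL m' : upd x.1 L m' L = m' by rewrite /upd eqxx.
have same : serve_inv (upd x.1 L m, upd x.2 k (x.2 k)) V' L.
  apply: (serve_upd inv sub VLk); rewrite ?updL //.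
  + by move=> ?; left.
  + by move=> ?; left.
(* Between rounds no room is active, so no answer is pending and nobody carries the colour about to
   be called. *)
have call : idle (x.2 k) -> acks m = 0 ->
    serve_inv (upd x.1 L (Memory (charge m) n d 1 (finished m)),
               upd x.2 k (Call d)) V' L.
  move=> idk a0.
  have no_act : \sum_k is_active (x.2 k) = 0 by rewrite act -/m a0.
  have noack : \sum_k is_ack (x.2 k) = 0 
    by move: ack_le; rewrite no_act leqn0 => /eqP.
  have unmarked i : mark (x.1 i) != d.
    by have := marked_le i; rewrite -/m -/d noack a0; case: eqP.
  apply: (serve_upd inv sub VLk); rewrite ?updL -/m -/d ?a0 ?wL ?eqxx //=.
  + by case: (x.2 k) idk.
  + by case: (x.2 k) idk.
  + by rewrite (negbTE (unmarked L)); case: (x.2 k) idk.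
  + by move=> _; right.
  + move=> _; right=> j _; have := sum_ge1 (fun j => is_active (x.2 j) : nat) j.
    by rewrite no_act; case: is_active.
have := RL k; case kE : (x.2 k) => [||||e||] //= e_d; rewrite -?kE -/m.
- by case: eqP => // a0; apply: call; rewrite ?kE.
- by case: eqP => // a0; apply: call; rewrite ?kE.
- by case: eqP => // a0; apply: call; rewrite ?kE.
- case: eqP => // a_n.
  have ak : is_active (x.2 k) by rewrite kE.
  have inactive j : j != k -> ~~ is_active (x.2 j) by apply: uniq.
  have noack : \sum_j is_ack (x.2 j) = 0.
    rewrite big1 // => j _; case: (eqVneq j k) => [->|/inactive]; first by rewrite kE.
    by case: (x.2 j).
  (* With [n] marks counted and none pending, the number of unmarked prisoners is zero. *)
  have marked i : mark (x.1 i) == d.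
    have : \sum_i (mark (x.1 i) == d) + \sum_i (mark (x.1 i) != d) = n.
      rewrite -big_split /= -[RHS]card_ord -sum1_card; apply: eq_bigr => j _.
      by case: eqP.
    rewrite mk -/m noack a_n addn0 => /eqP; rewrite -[X in _ == X]addn0 eqn_add2l.
    by rewrite sum_nat_eq0 => /forallP/(_ i); case: (mark _ == d).
  have act1 : \sum_j is_active (upd x.2 k Done j) = 0.
    rewrite big1 // => j _; rewrite /upd.
    by case: eqP => // /eqP /inactive /negbTE ->.
  split; rewrite /= ?updL //=.
  + by move=> i ne; rewrite /upd (negbTE ne); apply: wF.
  + move=> j; rewrite /upd; case: eqP => // /eqP /inactive.
    by have := RL j; case: (x.2 j).
  (* Incrementing [finished] flips the current colour, so all prisoners are unmarked for the next
     round. *)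
  + rewrite big1 => [|i _]; last first.
      have mL : mark m = d := eqP (marked L).
      rewrite /upd -/m -/d; case: (i == L) => /=; rewrite ?mL ?(eqP (marked i));
      by case: (d).
    apply/esym/eqP; rewrite add0n -leqn0 -[X in _ <= X]act1.
    by apply: leq_sum => j _; case: (upd _ _ _ j).
  + have := sum_upd (fun s => is_done s : nat) x.2 k Done.
    by rewrite kE dn /= addn0 addn1.
  + move=> i j; rewrite /upd; case: eqP => [-> _|/eqP nj].
      by apply/sub/vis; rewrite ak marked orbT.
    by rewrite (negbTE (inactive j nj)) orbF => dj; apply/sub/vis; rewrite dj.
- have a_gt0 : 0 < acks m.
    have := sum_ge1 (fun j => is_active (x.2 j) : nat) k.
    by rewrite act -/m kE; case: (0 < _).
  apply: (serve_upd inv sub VLk); rewrite ?updL -/m -/d ?wL ?kE ?a_gt0 //=.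
  + by lia.
  + by move=> _; apply: mkL.
  + by move=> _; left.
  + by move=> ?; left.
- exact: same.
Qed.

(** Conservation leaves no token outside [L]. The initial mark [true] differs from [odd 0], so
    nobody is marked; no room is active or done, so nothing is claimed about [V]. *)
Lemma serve_start b n r (x : state n r) V L :
  gather_inv b x -> n <= tokens (x.1 L) -> serve_inv x V L.
Proof.
move=> [Rx Mx Tx _] wL.
have tL := sum_ge1 (fun p => tokens (x.1 p)) L.
have L_n : tokens (x.1 L) = n by lia.
have inactive k : is_active (x.2 k) = false by have := Rx k; case: (x.2 k).
have undone k : is_done (x.2 k) = false by have := Rx k; case: (x.2 k).
have [mL aL fL] := Mx L.
split=> //; rewrite ?aL ?fL //=.
- move=> p ne; split; last by case: (Mx p).
  by have := sum_ge2 (fun p => tokens (x.1 p)) ne; lia.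
- move=> k; have := Rx k; case kE: (x.2 k) => //.
  have : room_tokens (x.2 k) <= \sum_j room_tokens (x.2 j).
    exact: (sum_ge1 (fun j => room_tokens (x.2 j))).
  have one : room_tokens (x.2 k) = 1 by rewrite kE.
  by lia.
- by rewrite big1 // => k _; rewrite inactive.
- rewrite !big1 // => [k _|p _]; last by case: (Mx p) => ->.
  by have := Rx k; case: (x.2 k).
- by rewrite big1 // => k _; rewrite undone.
- by move=> p k; rewrite inactive undone.
Qed.

(** * Progress of the service phase *)

(** The moves certain to lower [serve_pot]. Charges do not enter and idle states are treated alike,
    so the gathering moves of followers cannot disable a pair. *)
Definition enabled n (mL : memory) (leads mk : bool) (s : room) : bool :=
  match s with
  | Call e => if leads then acks mL == n else mk != e
  | Ack => leads
  | Token | Done => false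
  | _ => leads && (acks mL == 0)
  end.

(* A round consumes 2n + 1 units: two for each of the n marks, one of which is
   lent to the room while it is in state [Ack], and one for closing the room. *)
Definition serve_pot n r (x : state n r) (L : 'I_n) : nat :=
  (r - finished (x.1 L)) * n.*2.+1 - (acks (x.1 L)).*2 +
  \sum_k ~~ is_ack (x.2 k).

(** The term for [k] serves twice: a room that is not done leaves a round to be spent, and
    [finished = r] forces every room to be done. *)
Lemma finished_le n r (x : state n r) V L k :
  serve_inv x V L -> finished (x.1 L) + ~~ is_done (x.2 k) <= r.
Proof.
move=> inv; rewrite -(serve_done inv).
have rE : \sum_j is_done (x.2 j) + \sum_j ~~ is_done (x.2 j) = r.
  rewrite -big_split /= -[RHS]card_ord -sum1_card; apply: eq_bigr => j _.
  by case: is_done.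
by rewrite -[X in _ <= X]rE leq_add2l (sum_ge1 (fun j => ~~ is_done (x.2 j) : nat)).
Qed.

Lemma acks_le n r (x : state n r) V L :
  serve_inv x V L -> acks (x.1 L) + \sum_k is_ack (x.2 k) <= n.
Proof.
move=> inv; rewrite -(serve_marks inv) -[leqRHS]card_ord -sum1_card.
by apply: leq_sum => p _; case: (_ == _).
Qed.

(** Between rounds the leader can call a room that is not done. During a round it can collect an
    [Ack] or close a room with [n] marks; with fewer marks and none pending, some follower has yet
    to answer. *)
Lemma serve_enabled n r (x : state n r) V L :
  serve_inv x V L -> finished (x.1 L) < r ->
  exists p k, enabled n (x.1 L) (p == L) (mark (x.1 p)) (x.2 k).
Proof.
move=> inv lt_r; have [wL wF RL act mk mkL dn _] := inv.
have ack_le : \sum_j is_ack (x.2 j) <= \sum_j is_active (x.2 j).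
  by apply: leq_sum => j _; case: (x.2 j).
have [a0|a_gt0] := posnP (acks (x.1 L)).
  have [/existsP[k nd]|/existsPn done] := boolP [exists k, ~~ is_done (x.2 k)].
    exists L, k; have := sum_ge1 (fun j => is_active (x.2 j) : nat) k.
    by rewrite act a0 eqxx; have := RL k; case: (x.2 k) nd => //=; rewrite a0.
  move: lt_r; rewrite -dn (eq_bigr (fun=> 1)) => [|k _].
    by rewrite sum1_card card_ord ltnn.
  by have := done k; case: is_done.
have [k ak] : exists k, is_active (x.2 k).
  apply/existsP; apply: contraT => /existsPn no.
  by move: act; rewrite a_gt0 big1 // => k _; rewrite (negbTE (no k)).
case: (eqVneq (acks (x.1 L)) n) => [a_n|a_ne].
  by exists L, k; rewrite eqxx; have := RL k; case: (x.2 k) ak => //= *; apply/eqP.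
case kE : (x.2 k) (ak) => [||||e||] // _; last first.
  by exists L, k; rewrite kE /=.
have noack : \sum_j is_ack (x.2 j) = 0.
  rewrite big1 // => j _; case: (eqVneq k j) => [<-|ne]; first by rewrite kE.
  have := sum_ge2 (fun j => is_active (x.2 j) : nat) ne.
  by rewrite act ak a_gt0; case: (x.2 j).
have eE : e = odd (finished (x.1 L)) by have := RL k; rewrite kE => /eqP.
have [p np] : exists p, mark (x.1 p) != e.
  apply/existsP; apply: contraT => /existsPn all_e; case/negP: a_ne.
  rewrite -[acks _]addn0 -noack -mk (eq_bigr (fun=> 1)) => [|p _].
    by rewrite sum1_card card_ord.
  by rewrite -eE; have /negPn -> := all_e p.
(* The unmarked prisoner is not the leader, who marked itself when calling. *)
exists p, k; rewrite kE /= np; case: eqP => // pL.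
by move: np; rewrite pL mkL // eE eqxx.
Qed.

Lemma trans_called b n m e : 0 < n -> tokens m = 0 -> mark m != e ->
  (trans b n m (Call e)).2 = Ack.
Proof. by case: m => c w l a d n_gt0 /= -> /negbTE ->; rewrite ltn_eqF. Qed.

(** This is the alternative required by [eventually]: a step without a drop was not enabled and
    preserves the enabling of every pair. *)
Lemma serve_progress b n r (x : state n r) V L p k : serve_inv x V L ->
  let x' := step b x (p, k) in
  serve_pot x' L < serve_pot x L \/
  [/\ serve_pot x' L <= serve_pot x L,
      enabled n (x.1 L) (p == L) (mark (x.1 p)) (x.2 k) = false &
      forall q j, enabled n (x'.1 L) (q == L) (mark (x'.1 q)) (x'.2 j) =
                  enabled n (x.1 L) (q == L) (mark (x.1 q)) (x.2 j)].
Proof.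
move=> inv; have [wL wF RL act mk mkL dn _] := inv.
have n_gt0 : 0 < n by apply: leq_ltn_trans (ltn_ord L).
have fin_r := finished_le k inv.
rewrite /step /=.
case: (eqVneq p L) => [pL|ne]; last first.
  rewrite /serve_pot /=.
  have [w0 f0] := wF p ne.
  have nT : x.2 k <> Token by move=> E; have := RL k; rewrite E.
  have := trans_follower b n_gt0 w0 nT.
  have called e : x.2 k = Call e -> mark (x.1 p) != e ->
      (trans b n (x.1 p) (x.2 k)).2 = Ack.
    by move=> ->; apply: trans_called.
  case: trans called => m s /= called [w0' f0' H].
  have updL : upd x.1 p m L = x.1 L by rewrite /upd eq_sym (negbTE ne).
  have := sum_upd (fun s => ~~ is_ack s : nat) x.2 k s.
  rewrite updL; case: H => [[mm H]|[e kE [_ _ ->]]]; last first.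
    by rewrite kE /= addn0 addn1 => <-; left; rewrite addnS.
  have -> : is_ack s = is_ack (x.2 k).
    by case: H => [->|[]] //; case: (s); case: (x.2 k).
  move=> /addIn ->; right; split=> //.
    case: H => [E|[]]; last by case: (x.2 k).
    move: called E; case: (x.2 k) => //= e called.
    by case: eqP => // /eqP nm; rewrite (called e) // => /esym.
  move=> q j; have -> : mark (upd x.1 p m q) = mark (x.1 q).
    by rewrite /upd; case: eqP => [->|].
  rewrite /upd; case: (eqVneq j k) => [->|//].
  by case: H => [->|[]] //; case: (s); case: (x.2 k).
rewrite pL (trans_leader b (x.2 k) wL).
have same : enabled n (x.1 L) true (mark (x.1 L)) (x.2 k) = false ->
  let x' := (upd x.1 L (x.1 L), upd x.2 k (x.2 k)) in
  [/\ serve_pot x' L <= serve_pot x L,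
      enabled n (x.1 L) true (mark (x.1 L)) (x.2 k) = false &
      forall q j, enabled n (x'.1 L) (q == L) (mark (x'.1 q)) (x'.2 j) =
                  enabled n (x.1 L) (q == L) (mark (x.1 q)) (x.2 j)].
  have e1 q : upd x.1 L (x.1 L) q = x.1 q by rewrite /upd; case: eqP => [->|].
  have e2 j : upd x.2 k (x.2 k) j = x.2 j by rewrite /upd; case: eqP => [->|].
  move=> dis; split=> // [|q j]; last by rewrite /= !e1 e2.
  by rewrite /serve_pot /= e1 (eq_bigr (fun j => ~~ is_ack (x.2 j) : nat)) // => j; rewrite e2.
have drop m s : is_done (x.2 k) = false ->
    (r - finished m) * n.*2.+1 - (acks m).*2 + ~~ is_ack s <
    (r - finished (x.1 L)) * n.*2.+1 - (acks (x.1 L)).*2 + ~~ is_ack (x.2 k) ->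
  serve_pot (upd x.1 L m, upd x.2 k s) L < serve_pot x L.
  move=> nd; rewrite /serve_pot /= {1 2}/upd eqxx.
  have := sum_upd (fun s => ~~ is_ack s : nat) x.2 k s.
  do !move: (nat_of_bool _) => ?; do !move: (\sum_(_ < _) _) => ?.
  do !move: (_ - _) => ?; lia.
(* A room that is not done guarantees [finished < r], so one round can be split off the truncated
   difference. *)
have round : is_done (x.2 k) = false ->
    (r - finished (x.1 L)) * n.*2.+1 =
    (r - (finished (x.1 L)).+1) * n.*2.+1 + n.*2.+1.
  by move=> nd; rewrite -mulSnr subnSK // -addn1; rewrite nd in fin_r.
(* Twice the marks stays below [n.*2.+1], so the subtraction in [serve_pot] does not truncate. *)
have ack_n : acks (x.1 L) + is_ack (x.2 k) <= n.
  apply: leq_trans (acks_le inv); rewrite leq_add2l.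
  exact: (sum_ge1 (fun j => is_ack (x.2 j) : nat)).
have call : idle (x.2 k) -> let y := if acks (x.1 L) == 0
      then (Memory (charge (x.1 L)) n (odd (finished (x.1 L))) 1 (finished (x.1 L)),
            Call (odd (finished (x.1 L)))) else (x.1 L, x.2 k) in
    let x' := (upd x.1 L y.1, upd x.2 k y.2) in
    serve_pot x' L < serve_pot x L \/
    [/\ serve_pot x' L <= serve_pot x L,
      enabled n (x.1 L) true (mark (x.1 L)) (x.2 k) = false &
      forall q j, enabled n (x'.1 L) (q == L) (mark (x'.1 q)) (x'.2 j) =
                  enabled n (x.1 L) (q == L) (mark (x.1 q)) (x.2 j)].
  move=> idk; case: eqP => a0; [left; apply: drop|right; apply: same].
  - by case: (x.2 k) idk.
  - have nd : is_done (x.2 k) = false by case: (x.2 k) idk.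
    have na : is_ack (x.2 k) = false by case: (x.2 k) idk.
    rewrite /= na a0 (round nd); move: (_ * _) n_gt0 => A; clear=> /=; lia.
  - by case: (x.2 k) idk => //= _; apply/eqP.
case kE : (x.2 k) call => [||||e||] call; try exact: call.
- by have := RL k; rewrite kE.
- case: eqP => a_n; [left; apply: drop; rewrite kE // | right].
    by rewrite round ?kE //= a_n; move: (_ * _) n_gt0 => A; clear=> /=; lia.
  by rewrite -kE; apply: same; rewrite kE; apply/eqP.
- left; apply: drop; rewrite kE // round ?kE //=.
  by move: (_ * _) ack_n => A; rewrite kE; clear=> /=; lia.
- by right; rewrite -kE; apply: same; rewrite kE.
Qed.

(** * Runs under a valid schedule: election and end of service *)

Definition visited n r (sched : schedule n r) (t : nat) (p : 'I_n) (k : 'I_r) :=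
  exists2 t', t' < t & sched t' = (p, k).

Lemma serve_run_step a b n r (sched : schedule n r) t L :
  serve_inv (run a b sched t) (visited sched t) L ->
  serve_inv (run a b sched t.+1) (visited sched t.+1) L.
Proof.
move=> inv; rewrite [run _ _ _ _.+1]/(step b (run a b sched t) (sched t)).
case E: (sched t) => [p k]; apply: serve_step inv _ _ => [i j [t' lt st']|].
  by exists t' => //; apply: ltnW.
by exists t.
Qed.

Lemma gather_or_serve b n r (x : state n r) V :
  gather_inv b x -> leaderless x \/ exists L, serve_inv x V L.
Proof.
move=> inv; have [/existsP[L wL]|/existsPn no] := boolP [exists p, n <= tokens (x.1 p)].
  by right; exists L; apply: serve_start inv wL.
by left=> p; rewrite ltnNge.
Qed.

(** The gathering lemmas apply only to moves made before there is a leader, so the alternative is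
    decided anew after each of them; a leader, once elected, is permanent. *)
Lemma run_inv a b n r (sched : schedule n r) t : a * n = b * r + 1 ->
  gather_inv b (run a b sched t) /\ leaderless (run a b sched t) \/
  exists L, serve_inv (run a b sched t) (visited sched t) L.
Proof.
move=> bezout; have cases t' : gather_inv b (run a b sched t') ->
    gather_inv b (run a b sched t') /\ leaderless (run a b sched t') \/
    exists L, serve_inv (run a b sched t') (visited sched t') L.
  by move=> inv; have [] := gather_or_serve (visited sched t') inv; [left|right].
elim: t => [|t [[inv noL]|[L inv]]].
- exact/cases/gather_initial.
- exact/cases/gather_step.
- by right; exists L; apply: serve_run_step.
Qed.

(** Fairness applied to [pot]: a move that does not lower it changes nothing, so a pair able to
    lower it keeps this ability until it is scheduled. *)
Lemma leader_elected a b n r (sched : schedule n r) : 0 < r ->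
  a * n = b * r + 1 -> valid_schedule sched ->
  exists t L, serve_inv (run a b sched t) (visited sched t) L.
Proof.
move=> r_gt0 bezout fair; pose x t := run a b sched t.
pose drops (x : state n r) p k := let y := trans b n (x.1 p) (x.2 k) in
  pot_mem n y.1 + pot_room b n y.2 < pot_mem n (x.1 p) + pot_room b n (x.2 k).
suff [t _ [L inv]] : exists2 t, 0 <= t &
    exists L, serve_inv (x t) (visited sched t) L by exists t, L.
apply: (@eventually _ sched (fun t => pot b (x t)) _ (fun t pk =>
  [/\ gather_inv b (x t), leaderless (x t) & drops (x t) pk.1 pk.2])).
- by case=> p k t; apply: fair.
- move=> t _; case: (run_inv sched t bezout) => [[inv noL]|]; [right|by left].
  by have [p [k pk]] := gather_progress r_gt0 inv noL; exists (p, k).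
- move=> t [p k] _ [inv noL pk].
  have xS : x t.+1 = step b (x t) (sched t) by [].
  have invS : gather_inv b (x t.+1) by apply: gather_step.
  case E: (sched t) xS => [q j] xS.
  set old := pot_mem n ((x t).1 q) + pot_room b n ((x t).2 j).
  have potS := step_sum b (x t) q j (pot_mem n) (pot_room b n).
  rewrite -xS -!/(pot b _) -/old in potS.
  case: (trans_pot b (noL q) (gather_rooms inv j)) => H; last first.
    by left; rewrite -(ltn_add2r old) potS ltn_add2l.
  (* Writing back an unchanged value gives the same function only pointwise. *)
  have e1 i : (x t.+1).1 i = (x t).1 i.
    by rewrite xS /step /= H /upd; case: eqP => [->|].
  have e2 i : (x t.+1).2 i = (x t).2 i.
    by rewrite xS /step /= H /upd; case: eqP => [->|].
  right; split; first by case=> *; subst; move: pk; rewrite /drops H ltnn.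
    by rewrite -(leq_add2r old) potS H.
  by split=> // [i|]; rewrite /drops ?e1 ?e2 //; apply: noL.
Qed.

Lemma service_ends a b n r (sched : schedule n r) t0 L :
  valid_schedule sched ->
  serve_inv (run a b sched t0) (visited sched t0) L ->
  exists2 t, t0 <= t & r <= finished ((run a b sched t).1 L).
Proof.
move=> fair inv0; pose x t := run a b sched t.
have inv t : t0 <= t -> serve_inv (x t) (visited sched t) L.
  elim: t => [|t IH]; first by rewrite leqn0 => /eqP <-.
  by rewrite leq_eqVlt => /predU1P[<- //|/IH]; apply: serve_run_step.
apply: (@eventually _ sched (fun t => serve_pot (x t) L) _ (fun t pk =>
  enabled n ((x t).1 L) (pk.1 == L) (mark ((x t).1 pk.1)) ((x t).2 pk.2))).
- by case=> p k t; apply: fair.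
- move=> t /inv invt; rewrite leqNgt; case: ltnP => lt; [right|by left].
  by have [p [k pk]] := serve_enabled invt lt; exists (p, k).
- move=> t [p k] /inv invt pk.
  have xS : x t.+1 = step b (x t) (sched t) by [].
  case E: (sched t) xS => [q j] xS.
  have := serve_progress b q j invt; rewrite -xS => -[|[le off same]]; first by left.
  right; split=> //; last exact: (etrans (same p k) pk).
  by case=> *; subst; rewrite off in pk.
Qed.

Lemma finished_trans b n m s : finished m <= finished (trans b n m s).1.
Proof. by case: m => c w e a d /=; case: ifP; case: s => *; do ?case: ifP. Qed.

Lemma finished_run a b n r (sched : schedule n r) p t t' : t <= t' ->
  finished ((run a b sched t).1 p) <= finished ((run a b sched t').1 p).
Proof.
move=> le; rewrite -(subnKC le); elim: (t' - t) => [|d IH]; first by rewrite addn0.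
apply: leq_trans IH _; rewrite addnS /= /upd; case: eqP => // ->.
exact: finished_trans.
Qed.

(** * Encoding the protocol as a symmetric strategy *)

Definition code (s : room) : nat :=
  match s with
  | Fresh => 0 | Empty => 1 | Debt => 2 | Token => 3
  | Call false => 4 | Call true => 5 | Ack => 6 | Done => 7
  end.

(** The default [Done] decodes 7, and also makes [decode] total on the surplus states when [q]
    exceeds 8. State 0 is [Fresh], as the initial configuration requires. *)
Definition decode (i : nat) : room :=
  nth Done [:: Fresh; Empty; Debt; Token; Call false; Call true; Ack] i.

Lemma codeK : cancel code decode.
Proof. by case=> // -[]. Qed.

Lemma code_lt8 s : code s < 8.
Proof. by case: s => // -[]. Qed.

(** A strategy sees only observations, so the memory is recomputed from them. The room component is
    the state to be written; its initial [Fresh] is a placeholder that the first observation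
    overwrites. *)
Definition replay a b n (h : seq nat) : memory * room :=
  foldl (fun z i => trans b n z.1 (decode i)) (Memory (Posz a) 1 true 0 0, Fresh) h.

Definition strategy a b n r q (q_ge8 : 8 <= q) : sym_strategy q :=
  fun h => let z := replay a b n [seq val i | i <- h] in
    (Ordinal (leq_trans (code_lt8 z.2) q_ge8), finished z.1 == r).

Lemma replay_rcons a b n h i :
  replay a b n (rcons h i) = trans b n (replay a b n h).1 (decode i).
Proof. by rewrite /replay foldl_rcons. Qed.

Lemma config_run a b n r q (q_gt0 : 0 < q) (q_ge8 : 8 <= q) (sched : schedule n r) t :
  let c := config (strategy a b n r q_ge8) (fun=> Ordinal q_gt0) sched t in
  (forall p, (replay a b n [seq val i | i <- c.2 p]).1 = (run a b sched t).1 p) /\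
  (forall k, decode (c.1 k) = (run a b sched t).2 k).
Proof.
elim: t => [|t] //=; case: config => rooms hist /= [Hm Hr].
rewrite /step; case: (sched t) => p k /=; split=> i; rewrite /upd.
  by case: eqP => // _; rewrite map_rcons replay_rcons Hm Hr.
by case: eqP => // _ /=; rewrite codeK map_rcons replay_rcons Hm Hr.
Qed.

(** A declaration is decided after the current observation has been processed, hence the memory at
    time [t.+1]. *)
Lemma declares_run a b n r q (q_gt0 : 0 < q) (q_ge8 : 8 <= q) (sched : schedule n r) t :
  declares (strategy a b n r q_ge8) (fun=> Ordinal q_gt0) sched t =
  (finished ((run a b sched t.+1).1 (sched t).1) == r).
Proof.
have := config_run a b q_gt0 q_ge8 sched t; rewrite /declares.
case: config => rooms hist /= [Hm Hr]; rewrite /step.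
case: (sched t) => p k /=; rewrite /upd eqxx.
by rewrite map_rcons replay_rcons Hm Hr.
Qed.

Lemma coprime_winnable n r q : 0 < n -> 0 < r -> coprime n r -> 8 <= q ->
  sym_winnable n r q.
Proof.
move=> n_gt0 r_gt0 co q_ge8; have q_gt0 : 0 < q by apply: leq_trans q_ge8.
have [a [b bezout]] : exists a b, a * n = b * r + 1.
  by case: (egcdnP r n_gt0) => a b ab _; exists a, b; rewrite ab (eqP co).
exists q_gt0, (strategy a b n r q_ge8) => sched fair; split.
  have [t0 [L inv0]] := leader_elected r_gt0 bezout fair.
  have [t1 le1 fin1] := service_ends fair inv0.
  (* A declaration needs a visit, so the leader is awaited once more after its last round. *)
  have [t [le_t st]] := fair L (Ordinal r_gt0) t1.
  exists t; rewrite declares_run st /= eqn_leq.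
  have le_t1 := leq_trans fin1 (finished_run a b sched L (leq_trans le_t (leqnSn t))).
  rewrite le_t1 andbT.
  (* The counter cannot exceed [r]: it is 0 before the election and for followers, and counts done
     rooms for the leader. *)
  have [[[_ M _ _] _]|[L' inv]] := run_inv sched t.+1 bezout.
    by have [_ _ ->] := M L.
  have [LL'|ne] := eqVneq L L'; last by rewrite (serve_follower inv ne).2.
  by have := finished_le (Ordinal r_gt0) inv; rewrite -LL'; apply/leq_trans/leq_addr.
move=> t; rewrite declares_run => /eqP fin.
have [[[_ M _ _] _]|[L inv]] := run_inv sched t.+1 bezout.
  by have [_ _ f0] := M (sched t).1; rewrite f0 in fin; rewrite -fin in r_gt0.
have [pL|ne] := eqVneq (sched t).1 L; last first.
  by have := (serve_follower inv ne).2; rewrite fin => r0; rewrite r0 in r_gt0.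
(* The count [r] makes every room done, and a done room has been visited by everybody. *)
move=> p k; have [|t' le st'] := serve_visited inv (p := p) (k := k).
  have := finished_le k inv; rewrite -pL fin; case: is_done => //.
  by rewrite addn1 ltnn.
by exists t'.
Qed.

(** * Necessity of coprimality: lockstep schedules *)

(** Time is cut into stretches of length [d], in each of which one block of prisoners meets one
    block of rooms, member [i] taking the room at offset [i + shift] modulo [d]. The defaults [p0]
    and [k0] are never reached when [d] divides [n] and [r]. *)
Definition block_sched n r (p0 : 'I_n) (k0 : 'I_r) d (shift : nat -> nat) :
    schedule n r := fun t =>
  (insubd p0 (t %/ d %% (n %/ d) * d + t %% d),
   insubd k0 (t %/ d %/ (n %/ d) %% (r %/ d) * d + (t %% d + shift (t %/ d)) %% d)).

(** The quotient game, with one prisoner and one room per block and a round-robin schedule; no shift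
    occurs in it. *)
Fixpoint block_run q (S : sym_strategy q) (i0 : 'I_q) a b (T : nat) :
    (nat -> 'I_q) * (nat -> seq 'I_q) :=
  if T is T'.+1 then
    let x := block_run S i0 a b T' in
    let h := rcons (x.2 (T' %% a)) (x.1 (T' %/ a %% b)) in
    (upd x.1 (T' %/ a %% b) (S h).1, upd x.2 (T' %% a) h)
  else (fun=> i0, fun=> [::]).

Definition block_view q (S : sym_strategy q) (i0 : 'I_q) a b T : seq 'I_q :=
  let x := block_run S i0 a b T in
  rcons (x.2 (T %% a)) (x.1 (T %/ a %% b)).

Lemma block_sched_val n r (p0 : 'I_n) (k0 : 'I_r) d shift t :
  0 < d -> d %| n -> d %| r ->
  let pk := block_sched p0 k0 d shift t in
  (pk.1 = t %/ d %% (n %/ d) * d + t %% d :> nat) /\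
  (pk.2 = t %/ d %/ (n %/ d) %% (r %/ d) * d + (t %% d + shift (t %/ d)) %% d :> nat).
Proof.
move=> d_gt0 dn dr /=; rewrite !val_insubd.
have bound m A i : d %| m -> 0 < m -> i < d -> A %% (m %/ d) * d + i < m.
  move=> dm m_gt0 lt_i; rewrite -[X in _ < X](divnK dm).
  have : A %% (m %/ d) < m %/ d by rewrite ltn_mod divn_gt0 // dvdn_leq.
  move=> lt; apply: (@leq_trans ((A %% (m %/ d)).+1 * d)).
    by rewrite mulSn addnC ltn_add2r.
  by rewrite leq_mul2r lt orbT.
rewrite !bound ?ltn_pmod //; first exact: leq_ltn_trans (ltn_ord k0).
exact: leq_ltn_trans (ltn_ord p0).
Qed.

Lemma divmod_eq d A i m : 0 < d -> i < d ->
  (m == A * d + i) = (m %/ d == A) && (m %% d == i).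
Proof.
move=> d_gt0 lt_i; apply/eqP/andP => [->|[/eqP <- /eqP <-]].
  by rewrite divnMDl // modnMDl modn_small // divn_small // addn0 !eqxx.
exact: divn_eq.
Qed.

(** Adding [s] is injective modulo [d], so each member of a block enters a room not yet touched in
    the current stretch. *)
Lemma fresh_offset d j s : j < d ->
  ~~ has (fun i => (j + s) %% d == (i + s) %% d) (iota 0 j).
Proof.
move=> lt_j; apply/hasPn => i; rewrite mem_iota /= add0n => lt_i.
by rewrite eqn_modDr !modn_small ?(ltn_trans lt_i) // neq_ltn lt_i orbT.
Qed.

Definition block_inv n r q (S : sym_strategy q) i0 d shift T j
    (c : ('I_r -> 'I_q) * ('I_n -> seq 'I_q)) : Prop :=
  let a := n %/ d in let b := r %/ d in
  let x := block_run S i0 a b T in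
  let h := block_view S i0 a b T in
  (forall k, c.1 k =
     if (k %/ d == T %/ a %% b) &&
        has (fun i => k %% d == (i + shift T) %% d) (iota 0 j)
     then (S h).1 else x.1 (k %/ d)) /\
  (forall p, c.2 p =
     if (p %/ d == T %% a) && (p %% d < j) then h else x.2 (p %/ d)).

(** Members of a block have equal histories and find equal, still untouched rooms, so they all make
    the same move; after [d] visits both blocks are uniform again. *)
Lemma config_block n r q (S : sym_strategy q) i0 (p0 : 'I_n) (k0 : 'I_r) d shift T j :
  0 < d -> d %| n -> d %| r -> j <= d ->
  block_inv S i0 d shift T j
    (config S (fun=> i0) (block_sched p0 k0 d shift) (T * d + j)).
Proof.
move=> d_gt0 dn dr; have schedE t := block_sched_val p0 k0 shift t d_gt0 dn dr.
set sched := block_sched _ _ _ _ in schedE *; clearbody sched.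
have inner T' j' : j' <= d ->
    block_inv S i0 d shift T' 0 (config S (fun=> i0) sched (T' * d)) ->
    block_inv S i0 d shift T' j' (config S (fun=> i0) sched (T' * d + j')).
  move=> le_j inv0; elim: j' le_j => [|i IH] lt_i; first by rewrite addn0.
  have := IH (ltnW lt_i); rewrite addnS /=.
  have := schedE (T' * d + i).
  rewrite divnMDl // (divn_small lt_i) addn0 modnMDl (modn_small lt_i).
  case: config => rooms hist; case: (sched _) => p k /= [pE kE] [/= HR HH].
  have pd p' : (p' == p) = (p' %/ d == T' %% (n %/ d)) && (p' %% d == i).
    by rewrite -val_eqE /= pE divmod_eq.
  have kd k' : (k' == k) = (k' %/ d == T' %/ (n %/ d) %% (r %/ d)) &&
                           (k' %% d == (i + shift T') %% d).
    by rewrite -val_eqE /= kE divmod_eq // ltn_pmod.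
  have /andP[/eqP pA /eqP pi] : (p %/ d == T' %% (n %/ d)) && (p %% d == i).
    by rewrite -pd.
  have /andP[/eqP kB /eqP ki] : (k %/ d == T' %/ (n %/ d) %% (r %/ d)) &&
                           (k %% d == (i + shift T') %% d) by rewrite -kd.
  have view : rcons (hist p) (rooms k) = block_view S i0 (n %/ d) (r %/ d) T'.
    by rewrite HH HR pi ltnn andbF pA kB eqxx ki (negbTE (fresh_offset _ _)).
  split=> [k'|p'].
    rewrite -[i.+1]addn1 iotaD has_cat /= view kd HR orbF add0n.
    by case: eqP => //= _; rewrite orbC; case: eqP.
  rewrite /= view pd HH ltnS [p' %% d <= i]leq_eqVlt.
  by case: (p' %/ d == _) => //=; case: (p' %% d == i).
suff base T' : block_inv S i0 d shift T' 0 (config S (fun=> i0) sched (T' * d)).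
  by move=> le_j; apply: inner.
elim: T' => [|T' IH]; first by split=> [k|p] /=; rewrite andbF.
have [HR HH] := inner T' d (leqnn d) IH.
rewrite mulSn addnC; split=> [k|p] /=; rewrite andbF ?HR ?HH /= /upd.
  suff -> : has (fun i => k %% d == (i + shift T') %% d) (iota 0 d) by rewrite andbT.
  (* The visitor of room [k] is [k - shift T'] modulo [d], written without a negative term. *)
  apply/hasP; exists ((k %% d + (d - shift T' %% d)) %% d).
    by rewrite mem_iota /= add0n ltn_pmod.
  rewrite modnDml -modnDmr -addnA subnK; last by rewrite ltnW // ltn_pmod.
  by rewrite modnDr modn_mod.
by rewrite ltn_pmod // andbT.
Qed.

(** No shift appears on the right, so the warden can alter it without affecting any declaration. *)
Lemma declares_block n r q (S : sym_strategy q) i0 (p0 : 'I_n) (k0 : 'I_r) d shift t :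
  0 < d -> d %| n -> d %| r ->
  declares S (fun=> i0) (block_sched p0 k0 d shift) t =
  (S (block_view S i0 (n %/ d) (r %/ d) (t %/ d))).2.
Proof.
move=> d_gt0 dn dr; have lt_j := ltn_pmod t d_gt0.
have := config_block S i0 p0 k0 shift (t %/ d) d_gt0 dn dr (ltnW lt_j).
have := block_sched_val p0 k0 shift t d_gt0 dn dr.
rewrite -divn_eq /declares; case: config => rooms hist.
case: block_sched => p k /= [pE kE] [/= HR HH].
have /andP[/eqP pA /eqP pj] : (p %/ d == t %/ d %% (n %/ d)) && (p %% d == t %% d).
  by rewrite -divmod_eq // pE.
have /andP[/eqP kB /eqP kj] : (k %/ d == t %/ d %/ (n %/ d) %% (r %/ d)) &&
    (k %% d == (t %% d + shift (t %/ d)) %% d).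
  by rewrite -divmod_eq ?ltn_pmod // kE.
rewrite HR HH pA pj ltnn andbF kB eqxx kj /= (negbTE (fresh_offset _ _)) //.
Qed.

(** After stretch [C] the shift grows by one per full cycle of block meetings, so every offset
    between a prisoner and a room recurs. *)
Lemma block_sched_valid n r (p0 : 'I_n) (k0 : 'I_r) d C :
  0 < d -> d %| n -> d %| r ->
  valid_schedule (block_sched p0 k0 d
    (fun T => if T < C then 0 else T %/ (n %/ d * (r %/ d)))).
Proof.
move=> d_gt0 dn dr p k t0.
have a_gt0 : 0 < n %/ d.
  by rewrite divn_gt0 // dvdn_leq // (leq_ltn_trans _ (ltn_ord p0)).
have b_gt0 : 0 < r %/ d.
  by rewrite divn_gt0 // dvdn_leq // (leq_ltn_trans _ (ltn_ord k0)).
set a := n %/ d in a_gt0 *; set b := r %/ d in b_gt0 *.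
(* The cycle number [s] is congruent to [k - p] modulo [d] and at least [t0 + C]; in that cycle, [T]
   is the stretch where the block of [p] meets the block of [k]. *)
pose s := (k %% d + (d - p %% d)) + d * (t0 + C).
pose T := (s * b + k %/ d) * a + p %/ d.
have pa : p %/ d < a by rewrite ltn_divLR // divnK.
have kb : k %/ d < b by rewrite ltn_divLR // divnK.
have Ta : T %% a = p %/ d by rewrite modnMDl (modn_small pa).
have Tb : T %/ a = s * b + k %/ d by rewrite divnMDl // (divn_small pa) addn0.
have Tab : T %/ (a * b) = s by rewrite divnMA Tb divnMDl // (divn_small kb) addn0.
have s_le : t0 + C <= s.
  by apply: leq_trans (leq_addl _ _); rewrite leq_pmull.
have sT : s <= T.
  apply: leq_trans (leq_addr _ _); apply: leq_trans (leq_pmulr _ a_gt0).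
  by apply: leq_trans (leq_addr _ _); apply: leq_pmulr.
exists (T * d + p %% d); split.
  apply: leq_trans (leq_addr _ _); apply: leq_trans (leq_pmulr _ d_gt0).
  by apply: leq_trans sT; apply: leq_trans s_le; apply: leq_addr.
have lt_p := ltn_pmod p d_gt0.
have := block_sched_val p0 k0 (fun T => if T < C then 0 else T %/ (a * b))
  (T * d + p %% d) d_gt0 dn dr.
rewrite divnMDl // (divn_small lt_p) addn0 modnMDl (modn_small lt_p) -/a -/b.
rewrite Ta Tb modnMDl (modn_small kb) Tab.
have -> : (T < C) = false.
  by apply/negbTE; rewrite -leqNgt (leq_trans _ sT) // (leq_trans _ s_le) // leq_addl.
have -> : (p %% d + s) %% d = k %% d.
  rewrite /s addnA mulnC addnC modnMDl addnCA subnKC; last exact: ltnW.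
  by rewrite modnDr modn_mod.
rewrite -!divn_eq; case: block_sched => p' k' /= [pE kE].
by congr (_, _); apply: val_inj.
Qed.

Lemma winnable_coprime n r q : 0 < n -> 0 < r -> sym_winnable n r q -> coprime n r.
Proof.
move=> n_gt0 r_gt0 [q_gt0 [S win]]; set i0 := Ordinal q_gt0 in win.
set d := gcdn n r; have d_gt0 : 0 < d by rewrite gcdn_gt0 n_gt0.
have [dn dr] : d %| n /\ d %| r by rewrite dvdn_gcdl dvdn_gcdr.
apply: contraT => d_ne1; have d_gt1 : 1 < d by rewrite ltn_neqAle eq_sym d_ne1.
have r_gt1 : 1 < r by apply: leq_trans d_gt1 _; apply: dvdn_leq.
pose p0 := Ordinal n_gt0; pose k0 := Ordinal r_gt0.
have [[t dec] _] := win _ (block_sched_valid p0 k0 0 d_gt0 dn dr).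
(* The second schedule has the same declarations, but keeps shift 0 through the stretch containing
   [t]. *)
have [_ sound] := win _ (block_sched_valid p0 k0 (t %/ d).+1 d_gt0 dn dr).
rewrite declares_block // in dec.
have [|t' [le_t' st']] := sound t _ p0 (Ordinal r_gt1).
  by rewrite declares_block.
have := block_sched_val p0 k0 (fun T => if T < (t %/ d).+1 then 0 else
  T %/ (n %/ d * (r %/ d))) t' d_gt0 dn dr.
(* Prisoner 0 has offset 0 in its block, so under shift 0 it only enters rooms whose index is a
   multiple of [d], and room 1 is not one. *)
rewrite st' /= ltnS leq_div2r // addn0 modn_mod => -[/esym/eqP].
rewrite addn_eq0 => /andP[_ /eqP ->]; rewrite addn0 => one.
have : d %| 1 by rewrite one dvdn_mull.
by rewrite dvdn1 => /eqP d1; rewrite d1 in d_gt1.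
Qed.

Theorem theorem2 :
  (forall n r : nat, 0 < n -> 0 < r ->
     ((exists q, sym_winnable n r q) <-> coprime n r)) /\
  (exists f : nat -> nat, (forall m, 0 < m -> 0 < f m) /\
     forall n r : nat, 0 < n -> 0 < r -> coprime n r ->
       forall q, f (minn n r) <= q -> sym_winnable n r q).
Proof.
split=> [n r n_gt0 r_gt0|].
  split=> [[q]|co]; first exact: winnable_coprime.
  by exists 8; apply: coprime_winnable.
by exists (fun=> 8); split=> // n r n_gt0 r_gt0 co q; apply: coprime_winnable.
Qed.
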